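(* Let $d=(d_1,\ldots,d_n)$ be a degree sequence with $d_4\ge 2$, $\sum_i d_i>2n$, and $\mu_{odd}+\mu_1\ge 2$, and let $m=\frac12\sum_i d_i$. There is a bipartite cactus realization of $d$ if and only if $m\le\left\lfloor\frac{4(n-1)-\beta}{3}\right\rfloor$, where $\beta=\max\{\mu_1,\tfrac12(\mu_1+\mu_{odd})\}$.
   Context: A degree sequence is a sequence of integers $d_i\in\{1,\ldots,n-1\}$ with even sum and $d_1\ge\cdots\ge d_n$; a realization is a simple graph on $\{1,\ldots,n\}$ with $\deg(i)=d_i$. A cactus is a connected simple graph in which every edge lies on at most one cycle; a bi-cactus is a bipartite cactus. $\mu_1$ is the number of entries of $d$ equal to $1$, and $\mu_{odd}$ is the number of entries that are odd integers greater than $1$. *)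

(* Defs.v *)
From mathcomp Require Import all_boot.
Set Implicit Arguments. Unset Strict Implicit. Unset Printing Implicit Defensive.

(* Vertices {1,...,n} are represented by 'I_n (vertex i+1 <-> ordinal i). *)

Definition degree_sequence (n : nat) (d : seq nat) : Prop :=
  [/\ size d = n,
      all (fun x => (1 <= x) && (x <= n - 1)) d,
      ~~ odd (sumn d) &
      sorted geq d].

Definition simple_graph (n : nat) (e : rel 'I_n) : Prop :=
  (forall x, ~~ e x x) /\ (forall x y, e x y = e y x).

Definition deg (n : nat) (e : rel 'I_n) (x : 'I_n) : nat := #|[set y | e x y]|.

Definition realizes (n : nat) (e : rel 'I_n) (d : seq nat) : Prop :=
  simple_graph e /\ forall x : 'I_n, deg e x = nth 0 d x.

Definition connected_graph (n : nat) (e : rel 'I_n) : Prop :=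
  forall x y : 'I_n, connect e x y.

Definition is_graph_cycle (n : nat) (e : rel 'I_n) (s : seq 'I_n) : Prop :=
  [/\ 3 <= size s, uniq s & cycle e s].

Definition cycle_edges (n : nat) (s : seq 'I_n) : {set {set 'I_n}} :=
  [set [set x; next s x] | x in s].

Definition cactus (n : nat) (e : rel 'I_n) : Prop :=
  connected_graph e /\
  forall s1 s2 : seq 'I_n, is_graph_cycle e s1 -> is_graph_cycle e s2 ->
    forall E : {set 'I_n}, E \in cycle_edges s1 -> E \in cycle_edges s2 ->
      cycle_edges s1 = cycle_edges s2.

Definition bipartite (n : nat) (e : rel 'I_n) : Prop :=
  exists c : 'I_n -> bool, forall x y, e x y -> c x != c y.

Definition bi_cactus (n : nat) (e : rel 'I_n) : Prop :=
  cactus e /\ bipartite e.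

Definition mu1 (d : seq nat) : nat := count (fun x => x == 1) d.
Definition muodd (d : seq nat) : nat := count (fun x => odd x && (1 < x)) d.

(* beta = max{mu_1, (mu_1 + mu_odd)/2}; mu_1 + mu_odd is the number of odd
   entries, which is even for a degree sequence, so the halving is exact. *)
Definition beta (d : seq nat) : nat := maxn (mu1 d) ((mu1 d + muodd d)./2).

(* Main.v *)
Require Import Defs.
From mathcomp Require Import all_boot zify.
Set Implicit Arguments. Unset Strict Implicit. Unset Printing Implicit Defensive.

(** Necessity. Deleting an edge of a cycle of length at least 4 turns the other
    edges of that cycle into bridges, so [3 m + b] never decreases, where [m]
    counts edges and [b] bridges; it ends at a forest, where [b = m <= n - 1].
    Hence [3 m + b <= 4 (n - 1)]. Every leaf has its own bridge, and since the
    non-bridge edges at a vertex come in pairs, one pair per cycle through it,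
    every odd vertex meets a bridge: [b >= beta].

    Sufficiency. With [c = m - n + 1] cycles the inequality reads
    [n - 1 = 3 c + beta + t] for a slack [t >= 0]. A realization is built from a
    point by gluing pendant vertices and even cycles at a vertex. Backwards:
    remove a leaf from an odd vertex, or two leaves from an even vertex, or, when
    there is no leaf, a 4-cycle; these moves keep [t]. An odd [t] is made even by
    removing a [2] that subdivides the edge at a leaf. When [c = 1] and no leaf is
    left, the sequence is an even cycle. *)

(** * Cycles and bridges *)

Section Cycles.
Variable T : finType.
Implicit Types (e : rel T) (s p : seq T) (x y z : T).

Definition gdeg e x := #|[set y | e x y]|.
Definition gcycle e s : Prop := [/\ 3 <= size s, uniq s & cycle e s].
Definition gcycle_edges s : {set {set T}} := [set [set x; next s x] | x in s].
(** Connectedness is left out, so that the property survives the deletion of an edge. *)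
Definition gcactus e : Prop :=
  forall s1 s2, gcycle e s1 -> gcycle e s2 ->
    forall E, E \in gcycle_edges s1 -> E \in gcycle_edges s2 ->
      gcycle_edges s1 = gcycle_edges s2.

Lemma set2_eqP x y u w :
  [set x; y] = [set u; w] -> (x = u /\ y = w) \/ (x = w /\ y = u).
Proof.
move/setP => E; move: (E x) (E y) (E u) (E w); rewrite !inE !eqxx /= ?orbT.
by do 2![move=> /esym/orP[/eqP ?|/eqP ?]]; do 2![move=> /orP[/eqP ?|/eqP ?]];
  subst; auto.
Qed.

Lemma set2C x y : [set x; y] = [set y; x].
Proof. exact: setUC. Qed.

Lemma mem_gcycle_edges s x y : uniq s ->
  ([set x; y] \in gcycle_edges s) =
  (x \in s) && ((y == next s x) || (y == prev s x)).
Proof.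
move=> us; apply/imsetP/andP.
  case=> u us' /set2_eqP[[-> ->]|[-> ->]]; first by rewrite eqxx.
  by rewrite mem_next prev_next // eqxx orbT.
case=> xs /orP[/eqP->|/eqP->]; first by exists x.
by exists (prev s x); rewrite ?mem_prev // next_prev // set2C.
Qed.

(** Rotate [x] to the front: its successor is then the second entry and its predecessor the last
    one, and a repetition-free cycle of length at least 3 keeps them apart. *)
Lemma next_neq_prev e s x : gcycle e s -> x \in s -> next s x != prev s x.
Proof.
case=> ss us _ xs; have [i p Ep] := rot_to xs.
rewrite -(next_rot i us) -(prev_rot i us) Ep.
have up : uniq (x :: p) by rewrite -Ep rot_uniq.
have: size (x :: p) = size s by rewrite -Ep size_rot.
have prevE y q : x \notin q -> prev_at x x y q = last y q.
  elim: q y => [|z q IH] y /=; first by rewrite eqxx.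
  by rewrite inE negb_or => /andP[/negbTE-> /IH].
case: p {Ep} up => [|a [|b p]] up; rewrite /= ?eqxx; try lia.
move: up; rewrite /= !inE !negb_or => /andP[/and3P[xa xb xp] /and3P[/andP[ab ap] bp _]].
move=> _; rewrite (negbTE xa) (negbTE xb) prevE //.
have := mem_last b p; rewrite inE; case/orP => [/eqP->//|H].
by apply: contraNneq ap => ->.
Qed.

Lemma gcycle_next e s x : gcycle e s -> x \in s -> e x (next s x).
Proof. by case=> _ _ ce xs; apply: next_cycle. Qed.

Lemma gcycle_prev e s x : symmetric e -> gcycle e s -> x \in s -> e x (prev s x).
Proof. by move=> se [_ _ ce] xs; rewrite se; apply: prev_cycle. Qed.

Lemma gcycle_sub e e' s :
  (forall x y, e' x y -> e x y) -> gcycle e' s -> gcycle e s.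
Proof. by move=> H [ss us cs]; split=> //; apply: sub_cycle cs. Qed.

Lemma gcycle_deg2 e s x a b : symmetric e -> gcycle e s -> x \in s ->
  (forall y, e x y -> y \in [set a; b]) ->
  a != b /\ [set next s x; prev s x] = [set a; b].
Proof.
move=> se cs xs H.
have:= H _ (gcycle_next cs xs); have:= H _ (gcycle_prev se cs xs).
have:= next_neq_prev cs xs; rewrite !inE => ne /orP[]/eqP pE /orP[]/eqP nE;
  move: ne; rewrite pE nE ?eqxx // => ne.
by rewrite eq_sym set2C.
Qed.

(** A repetition-free sequence has at most [#|T|] entries, so bounding the length loses no cycle and
    makes the property boolean. *)
Definition on_cycle e x y : bool :=
  [exists s : #|T|.-bseq T, [&& 3 <= size s, uniq s, cycle e s &
     [set x; y] \in gcycle_edges s]].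

Lemma on_cycleP e x y :
  reflect (exists2 s, gcycle e s & [set x; y] \in gcycle_edges s) (on_cycle e x y).
Proof.
apply: (iffP existsP) => [[s /and4P[a b c d]]|[s [a b c] d]]; first by exists s.
have sz : size s <= #|T| by rewrite -(card_uniqP b) max_card.
by exists (Bseq sz); apply/and4P.
Qed.

Definition bridge e x y := e x y && ~~ on_cycle e x y.

Lemma on_cycleC e x y : on_cycle e x y = on_cycle e y x.
Proof. by rewrite /on_cycle set2C. Qed.

Lemma bridgeC e x y : symmetric e -> bridge e x y = bridge e y x.
Proof. by move=> se; rewrite /bridge se on_cycleC. Qed.

(* The edges at [x] lying on cycles are grouped by their cycle, two in each. *)
Lemma even_on_cycle_nbrs e x : symmetric e -> gcactus e ->
  ~~ odd #|[set y | e x y && on_cycle e x y]|.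
Proof.
move=> se ca; set N := [set y | _].
pose R y z := [exists s : #|T|.-bseq T, [&& 3 <= size s, uniq s, cycle e s,
     [set x; y] \in gcycle_edges s & [set x; z] \in gcycle_edges s]].
have RP y z : reflect (exists s, [/\ gcycle e s, [set x; y] \in gcycle_edges s
    & [set x; z] \in gcycle_edges s]) (R y z).
  apply: (iffP existsP) => [[s /and5P[a b c d f]]|[s [[a b c] d f]]]; first by exists s.
  have sz : size s <= #|T| by rewrite -(card_uniqP b) max_card.
  by exists (Bseq sz); apply/and5P.
(* Transitivity is where the cactus property enters: two cycles with a common edge have the same
   edges. *)
have eqR : {in N & &, equivalence_rel R}.
  move=> y z w; rewrite !inE => _ _ /andP[_ /on_cycleP[s cs ys]]; split.
    by apply/RP; exists s; split.
  move=> /RP[s1 [c1 y1 z1]]; apply/RP/RP=> -[s2 [c2 u2 w2]]; exists s1; split=> //.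
    by rewrite (ca _ _ c1 c2 _ y1 u2).
  by rewrite (ca _ _ c1 c2 _ z1 u2).
have pN := equivalence_partitionP eqR.
rewrite (@card_uniform_partition _ 2 _ _ _ pN) => [|A /imsetP[y yN ->]].
  by rewrite oddM andbF.
move: yN; rewrite inE => /andP[exy /on_cycleP[s cs ys]].
have us : uniq s by case: cs.
have:= ys; rewrite mem_gcycle_edges // => /andP[xs _].
have nb z : [set x; z] \in gcycle_edges s -> e x z.
  rewrite mem_gcycle_edges // => /andP[_ /orP[]/eqP->].
    exact: gcycle_next. exact: gcycle_prev.
suff -> : [set z in N | R y z] = [set next s x; prev s x].
  by rewrite cards2 (next_neq_prev cs xs).
apply/setP=> z; rewrite !inE.
have E : ([set x; z] \in gcycle_edges s) = (z == next s x) || (z == prev s x).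
  by rewrite mem_gcycle_edges // xs.
rewrite -E; apply/idP/idP => [/andP[_ /RP[s1 [c1 y1 z1]]]|zs].
  by rewrite (ca _ _ cs c1 _ ys y1).
rewrite nb //=; apply/andP; split; first by apply/on_cycleP; exists s.
by apply/RP; exists s; split.
Qed.

(** The edges at [x] that lie on cycles are even in number, so the bridges at [x] carry the parity
    of its degree. *)
Lemma odd_bridges e x : symmetric e -> gcactus e ->
  odd #|[set y | bridge e x y]| = odd (gdeg e x).
Proof.
move=> se ca; rewrite /gdeg -(cardsID [set y | on_cycle e x y] [set y | e x y]).
rewrite oddD -[X in X (+) _](_ : false = _); last first.
  apply/esym/negbTE; have := even_on_cycle_nbrs x se ca.
  by congr (~~ odd #|pred_of_set _|); apply/setP=> y; rewrite !inE.
rewrite /=; congr (odd #|pred_of_set _|); apply/setP=> y.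
by rewrite !inE andbC.
Qed.

End Cycles.

(** * Counting edges and bridges *)

Section Counting.
Variable T : finType.
Implicit Types (e : rel T) (s p : seq T) (x y z : T) (A : {set T}).

(* A longest path starts at a vertex all of whose neighbours lie on the path. *)
Lemma min_deg2_gcycle e A x0 : irreflexive e -> symmetric e -> x0 \in A ->
  (forall x, x \in A -> 2 <= #|[set y in A | e x y]|) -> exists s, gcycle e s.
Proof.
move=> ie se x0A dA.
have grow k : (exists s, gcycle e s) \/
    exists x p, [/\ uniq (x :: p), path e x p, {subset x :: p <= A} & size p = k].
  elim: k => [|k [?|[x [p [up pp sA sp]]]]]; last 2 first.
  - by left.
  - have xA : x \in A by apply: sA; rewrite mem_head.
    (* The path grows at its front, so [head x p] is the vertex after [x] on it. A neighbour other
       than that one either extends the path or closes a cycle of length at least 3. *)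
    have [z zA zh] : exists2 z, z \in [set y in A | e x y] & z != head x p.
      have := dA _ xA; rewrite (cardsD1 (head x p)) => h.
      have : 0 < #|[set y in A | e x y] :\ head x p|.
        by case: (_ \in _) h; lia.
      by rewrite card_gt0 => /set0Pn[z]; rewrite in_setD1 => /andP[? ?]; exists z.
    move: zA; rewrite inE => /andP[zA exz].
    have zx : z != x by apply: contraTneq exz => ->; rewrite ie.
    have [zp|zp] := boolP (z \in p).
      left; case/splitPr: zp up pp zh {sA sp} => p1 p2 up pp zh.
      exists (x :: rcons p1 z); split.
      + by case: p1 zh {up pp} => [|a [|b p1]] /=; rewrite ?eqxx ?size_rcons.
      + by move: up; rewrite -cat_rcons -cat_cons cat_uniq => /andP[].
      + rewrite /= rcons_path last_rcons se exz andbT.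
        by move: pp; rewrite -cat_rcons cat_path => /andP[].
    right; exists z, (x :: p); split; rewrite /= ?sp //.
    + by rewrite inE negb_or zx zp.
    + by rewrite se exz.
    + by move=> w; rewrite inE => /predU1P[->|/sA].
  right; exists x0, [::]; split=> // y; by rewrite inE => /eqP->.
have [//|[x [p [up _ _ sp]]]] := grow #|T|.
by have := max_card (mem (x :: p)); rewrite (card_uniqP up) /= sp ltnn.
Qed.

(** The double sum counts every edge twice. The induction removes a vertex with at most one
    neighbour in [A]; if there were none, [min_deg2_gcycle] would give a cycle. *)
Lemma forest_edges e A : irreflexive e -> symmetric e -> (forall s, ~ gcycle e s) ->
  0 < #|A| -> \sum_(x in A) \sum_(y in A) e x y + 2 <= 2 * #|A|.
Proof.
move=> ie se ac; have [N] := ubnP #|A|; elim: N A => // N IH A AN A0.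
have [x0 x0A] : exists x0, x0 \in A by apply/set0Pn; rewrite -card_gt0.
have [x xA dx] : exists2 x, x \in A & \sum_(y in A) e x y <= 1.
  have [/forall_inP H|] := boolP [forall x in A, 2 <= #|[set y in A | e x y]|].
    by have [s /ac] := min_deg2_gcycle ie se x0A H.
  rewrite negb_forall_in => /exists_inP[x xA]; rewrite -ltnNge ltnS => H.
  exists x => //; apply: leq_trans H.
  rewrite -sum1dep_card big_mkcondr /=; apply: leq_sum => y _.
  by case: (e x y).
rewrite (big_setD1 _ xA) /=.
have -> : \sum_(i in A :\ x) \sum_(y in A) e i y =
    \sum_(i in A :\ x) e x i + \sum_(i in A :\ x) \sum_(y in A :\ x) e i y.
  rewrite -big_split /=; apply: eq_bigr => i _.
  by rewrite (big_setD1 _ xA) /= se.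
have := dx; rewrite (big_setD1 _ xA) /= ie add0n => dx'.
have cA : #|A| = #|A :\ x|.+1 by rewrite (cardsD1 x) xA.
have [Ax0|Ax] := posnP #|A :\ x|.
  have /eqP -> : A :\ x == set0 by rewrite -cards_eq0 Ax0.
  by rewrite !big_set0; lia.
have := IH (A :\ x); rewrite cA in AN *; move=> /(_ _ Ax); lia.
Qed.

Lemma bipartite_gcycle_size e s (c : T -> bool) :
  (forall x y, e x y -> c x != c y) -> gcycle e s -> 4 <= size s.
Proof.
move=> bc [s3 _]; case: s s3 => [|x [|y [|z [|w s]]]] //= _.
case/and4P => /bc + /bc + /bc + _.
by case: (c x); case: (c y); case: (c z).
Qed.

(** Ordered pairs are counted, so each edge of an irreflexive symmetric relation counts twice. *)
Definition num_arcs (r : rel T) := \sum_x \sum_y r x y.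

(** This is twice [3 m + b <= 4 (n - 1)]. Deleting an edge of a cycle loses 2 arcs and creates at
    least 6 bridge arcs, so the left side does not decrease. *)
Lemma cactus_arcs e (c : T -> bool) : irreflexive e -> symmetric e -> gcactus e ->
  (forall x y, e x y -> c x != c y) -> 0 < #|T| ->
  3 * num_arcs e + num_arcs (bridge e) + 8 <= 8 * #|T|.
Proof.
move=> + + + + T0; have [N] := ubnP (num_arcs e); elim: N e => // N IH e eN ie se ca bc.
have numE (r : rel T) : num_arcs r = #|[set q : T * T | r q.1 q.2]|.
  rewrite /num_arcs pair_bigA /= -sum1dep_card [RHS]big_mkcond.
  by apply: eq_bigr => q _; case: (r _ _).
have [/existsP[x0 /existsP[y0 oxy]]|noc] := boolP [exists x, exists y, on_cycle e x y]; last first.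
  have ac s : ~ gcycle e s.
    move=> cs; case/negP: noc; case: s cs => [[]//|x s] cs.
    apply/existsP; exists x; apply/existsP; exists (next (x :: s) x).
    by apply/on_cycleP; exists (x :: s) => //; apply/imsetP; exists x; rewrite ?mem_head.
  have : num_arcs (bridge e) <= num_arcs e.
    rewrite !numE; apply: subset_leq_card; apply/subsetP => q; rewrite !inE.
    by case/andP.
  have := @forest_edges e [set: T] ie se ac; rewrite cardsT => /(_ T0).
  rewrite (eq_bigr (fun x => \sum_y (e x y))) => [|x _]; last by apply: eq_bigl => y; rewrite inE.
  rewrite (eq_bigl xpredT) => [|x]; last by rewrite inE.
  rewrite -/(num_arcs e); lia.
have [x [y [z [w [s cs]]]]] : exists x y z w s, gcycle e [:: x, y, z, w & s].
  case/on_cycleP: oxy => s cs _; have := bipartite_gcycle_size bc cs.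
  by case: s cs => [|x [|y [|z [|w s]]]] // cs _; exists x, y, z, w, s.
set C := [:: _, _, _, _ & _] in cs.
have uC : uniq C by case: cs.
(* The vertex after [w] on the cycle, which is [x] again when the cycle has length 4. *)
pose t := head x s.
have exy : e x y by case: cs => _ _ /= /andP[].
pose e' : rel T := fun u v => e u v && ([set u; v] != [set x; y]).
have ie' : irreflexive e' by move=> u; rewrite /e' ie.
have se' : symmetric e' by move=> u v; rewrite /e' se set2C.
have sub u v : e' u v -> e u v by case/andP.
have ca' : gcactus e'.
  by move=> s1 s2 c1 c2; apply: ca; apply: gcycle_sub (sub) _.
have arcs' : num_arcs e = num_arcs e' + 2.
  rewrite !numE.
  have -> : [set q | e q.1 q.2] = [set q : T * T | e' q.1 q.2] :|: [set (x, y); (y, x)].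
    apply/setP => -[u v]; rewrite !inE /e' /= !xpair_eqE.
    have [E|NE] := eqVneq [set u; v] [set x; y].
      by rewrite andbF /=; case: (set2_eqP E) => -[-> ->]; rewrite !eqxx ?orbT // se.
    rewrite andbT; case: (e u v) => //=; apply/esym/negbTE/negP.
    by case/orP => /andP[/eqP uE /eqP vE]; case/eqP: NE; rewrite uE vE // set2C.
  rewrite cardsU (_ : _ :&: _ = set0) ?cards0 ?subn0.
    congr (_ + _); rewrite cards2 xpair_eqE.
    by case: eqVneq exy => [->|//]; rewrite ie.
  apply/setP => -[u v]; rewrite !inE /e' /= !xpair_eqE.
  apply/negbTE/negP => /andP[/andP[_ NE]].
  by case/orP => /andP[/eqP uE /eqP vE]; case/eqP: NE; rewrite uE vE // set2C.
have xyC : [set x; y] \in gcycle_edges C.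
  by apply/imsetP; exists x; rewrite ?mem_head //= eqxx.
(* A cycle of [e'] through [uv] shares an edge with [C], hence has the same edges as [C], among them
   the deleted edge [xy]. *)
have newbr u v : e' u v -> [set u; v] \in gcycle_edges C -> bridge e' u v && ~~ bridge e u v.
  move=> uv uvC; rewrite /bridge uv sub //= negbK; apply/andP; split; last first.
    by apply/on_cycleP; exists C.
  apply/on_cycleP => -[s1 c1 uv1].
  have := xyC; rewrite (ca _ _ cs (gcycle_sub sub c1) _ uvC uv1).
  have [_ u1 _] := c1.
  rewrite mem_gcycle_edges // => /andP[xs1 /orP[]/eqP yE].
    by have := gcycle_next c1 xs1; rewrite -yE /e' eqxx andbF.
  by have := gcycle_prev se' c1 xs1; rewrite -yE /e' eqxx andbF.
have oldbr u v : bridge e u v -> bridge e' u v.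
  case/andP => uv noc; apply/andP; split.
    rewrite /e' uv; apply: contraNneq noc => E; apply/on_cycleP; exists C => //.
    by rewrite E.
  apply: contraNN noc => /on_cycleP[s1 c1 uv1]; apply/on_cycleP; exists s1 => //.
  exact: gcycle_sub c1.
have brs : num_arcs (bridge e) + 6 <= num_arcs (bridge e').
  (* The three edges of [C] that follow [xy], in both directions. *)
  pose D := [:: (y, z); (z, y); (z, w); (w, z); (w, t); (t, w)].
  have [xy xz xw] : [/\ x != y, x != z & x != w].
    by move: uC; rewrite /= !inE !negb_or => /andP[/and4P[]].
  have [yz yw zw] : [/\ y != z, y != w & z != w].
    by move: uC; rewrite /= !inE !negb_or => /and4P[_ /and3P[-> -> _] /andP[-> _]].
  have [yx zx wx] : [/\ y != x, z != x & w != x] by rewrite ![_ == x]eq_sym.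
  have [zy wy wz] : [/\ z != y, w != y & w != z].
    by rewrite (eq_sym z) (eq_sym w) (eq_sym w z).
  have [ty tz tw] : [/\ t != y, t != z & t != w].
    move: uC; rewrite /t /C; case: (s) => [|a s'] //=.
    rewrite !inE !negb_or => /and5P[_ /and4P[_ _ ? _] /and3P[_ ? _] /andP[? _] _].
    by split; rewrite eq_sym.
  have [eyz ezw ewt] : [/\ e y z, e z w & e w t].
    case: cs => _ _ /= /and4P[_ -> ->]; rewrite /t.
    by case: (s) => [|a s'] /= /andP[->].
  have yzC : [set y; z] \in gcycle_edges C.
    apply/imsetP; exists y; first by rewrite !inE eqxx orbT.
    by rewrite /= (negbTE yx) eqxx.
  have zwC : [set z; w] \in gcycle_edges C.
    apply/imsetP; exists z; first by rewrite !inE eqxx !orbT.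
    by rewrite /= (negbTE zx) (negbTE zy) eqxx.
  have wtC : [set w; t] \in gcycle_edges C.
    apply/imsetP; exists w; first by rewrite !inE eqxx !orbT.
    rewrite /= (negbTE wx) (negbTE wy) (negbTE wz) /t.
    by case: (s) => [|a s'] /=; rewrite eqxx.
  have neq u v : v != x -> v != y -> [set u; v] != [set x; y].
    move=> vx vy; apply/eqP => /setP/(_ v).
    by rewrite !inE eqxx orbT (negbTE vx) (negbTE vy).
  have e'yz : e' y z by rewrite /e' eyz neq.
  have e'zw : e' z w by rewrite /e' ezw neq.
  have e'wt : e' w t by rewrite /e' ewt set2C neq.
  have Dbr q : q \in D -> bridge e' q.1 q.2 && ~~ bridge e q.1 q.2.
    rewrite !inE; case/or4P => [||| /or3P[]] /eqP-> /=; apply: newbr => //.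
    - by rewrite se'.
    - by rewrite set2C.
    - by rewrite se'.
    - by rewrite set2C.
    - by rewrite se'.
    - by rewrite set2C.
  have uD : uniq D.
    rewrite /= !inE !xpair_eqE.
    have [yt zt wt] : [/\ y != t, z != t & w != t] by rewrite ![_ == t]eq_sym.
    by rewrite !(negbTE yz, negbTE yw, negbTE zw, negbTE zy, negbTE wy, negbTE wz,
      negbTE ty, negbTE tz, negbTE tw, negbTE yt, negbTE zt, negbTE wt, andbF, andFb, orbF).
  rewrite !numE.
  have -> : 6 = #|[set q in D]| by rewrite cardsE (card_uniqP uD).
  rewrite -leq_subRL ?subset_leq_card //; last first.
    by apply/subsetP => q; rewrite !inE; apply: oldbr.
  rewrite -cardsDS; last by apply/subsetP => q; rewrite !inE; apply: oldbr.
  apply: subset_leq_card; apply/subsetP => q; rewrite inE => /Dbr /andP[b b'].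
  by rewrite in_setD !inE b b'.
have := IH e' _ ie' se' ca'; move=> /(_ _ (fun u v uv => bc u v (sub u v uv))); lia.
Qed.

Lemma sum_nat_bool (p : pred T) : \sum_x (p x : nat) = #|[set x | p x]|.
Proof.
by rewrite -sum1dep_card [RHS]big_mkcond; apply: eq_bigr => x _; case: (p x).
Qed.

Lemma num_arcsE (r : rel T) : num_arcs r = \sum_x #|[set y | r x y]|.
Proof. by apply: eq_bigr => x _; rewrite sum_nat_bool. Qed.

(** By parity every vertex of odd degree is the start of at least one bridge arc. *)
Lemma odd_deg_bridges e : symmetric e -> gcactus e ->
  #|[set x | odd (gdeg e x)]| <= num_arcs (bridge e).
Proof.
move=> se ca; rewrite num_arcsE -sum_nat_bool; apply: leq_sum => x _.
by rewrite -odd_bridges //; case: #|[set _ | _]| => //= n; case: (odd n).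
Qed.

(** By parity the edge at a leaf is a bridge, and its other end is not a leaf. Each leaf thus
    accounts for one bridge arc starting in [L] and one starting outside [L]. *)
Lemma leaf_bridges e : symmetric e -> gcactus e ->
  (forall x y, e x y -> gdeg e x = 1 -> gdeg e y != 1) ->
  2 * #|[set x | gdeg e x == 1]| <= num_arcs (bridge e).
Proof.
move=> se ca nl; set L := [set x | _].
have brL x : x \in L -> 1 <= \sum_y bridge e x y.
  rewrite inE sum_nat_bool => /eqP dx; have := odd_bridges x se ca.
  by rewrite dx; case: #|[set _ | _]|.
have -> : 2 * #|L| = \sum_(x in L) 1 + \sum_(x in L) 1 by rewrite sum1_card; lia.
rewrite /num_arcs [leqRHS](bigID (mem L)) /=; apply: leq_add; first exact: leq_sum.
apply: (@leq_trans (\sum_(x in L) \sum_(y | y \notin L) bridge e x y)).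
  apply: leq_sum => x xL; apply: leq_trans (brL x xL) _.
  rewrite (bigID (mem L)) /= big1 // => y yL.
  apply/eqP; rewrite eqb0; apply/negP => /andP[exy _]; move: xL yL; rewrite !inE => /eqP xL.
  by rewrite (negbTE (nl _ _ exy xL)).
rewrite exchange_big /=; apply: leq_sum => y _.
rewrite [leqRHS](bigID (mem L)) /=; apply: leq_trans (leq_addr _ _).
by apply: leq_sum => x _; rewrite bridgeC.
Qed.

(** Two adjacent leaves form a whole connected component. *)
Lemma adjacent_leaves e x y : symmetric e -> (forall u v, connect e u v) ->
  e x y -> gdeg e x = 1 -> gdeg e y = 1 -> #|T| <= 2.
Proof.
move=> se con exy /eqP/cards1P[a xa] /eqP/cards1P[b yb].
have ay : a = y by apply/esym/set1P; rewrite -xa inE.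
have bx : b = x by apply/esym/set1P; rewrite -yb inE se.
have clos : closed e [set x; y].
  apply: (intro_closed (sym_connect_sym se)) => u v euv.
  rewrite !inE => /orP[]/eqP uE; move: euv; rewrite {}uE => euv.
    have : v \in [set a] by rewrite -xa inE.
    by rewrite ay inE => ->; rewrite orbT.
  have : v \in [set b] by rewrite -yb inE.
  by rewrite bx inE => ->.
rewrite -cardsT (_ : [set: T] = [set x; y]) ?cards2 ?ltnS ?leq_b1 //.
by apply/setP => u; rewrite inE -(closed_connect clos (con x u)) !inE eqxx.
Qed.

End Counting.

(** * Reduction of degree sequences *)

Lemma odd_sumn d : odd (sumn d) = odd (mu1 d + muodd d).
Proof.
elim: d => //= x d; rewrite /mu1 /muodd /=; case: x => [|[|x]] /=; lia.
Qed.

(** Entrywise [3 <= x + 2 [x = 1] + [x = 2]]. This forces many entries 2 when there are few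
    leaves. *)
Lemma size3_le_sumn d : all (leq 1) d ->
  3 * size d <= sumn d + 2 * mu1 d + count_mem 2 d.
Proof. by rewrite /mu1; elim: d => //= x d IH /andP[x1 /IH]; lia. Qed.

Lemma size2_le_sumn d : all (leq 1) d ->
  2 * size d + count (leq 3) d <= sumn d + mu1 d.
Proof. by rewrite /mu1; elim: d => //= x d IH /andP[x1 /IH]; lia. Qed.

Lemma sumn_le_size2 d : all (geq 2) d -> all (leq 1) d ->
  sumn d + mu1 d <= 2 * size d.
Proof. by rewrite /mu1; elim: d => //= x d IH /andP[x1 /IH] H /andP[x2 /H]; lia. Qed.

Lemma perm_nseq_count (T : eqType) k (y : T) d : k <= count_mem y d ->
  exists d', perm_eq d (nseq k y ++ d').
Proof.
elim: k d => [|k IH] d kd; first by exists d.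
have yd : y \in d by rewrite -has_pred1 has_count; lia.
have P := perm_to_rem yd.
case: (IH (rem y d)) => [|d' P']; first by move/permP: P kd => /(_ (pred1 y)) ->; rewrite /= eqxx.
by exists d'; rewrite (perm_trans P) //= perm_cons.
Qed.

Lemma mu1_perm d d' : perm_eq d d' -> mu1 d = mu1 d'.
Proof. by move/permP; apply. Qed.
Lemma muodd_perm d d' : perm_eq d d' -> muodd d = muodd d'.
Proof. by move/permP; apply. Qed.

Lemma mem_rem_neq (T : eqType) (x y : T) d : x != y -> x \in d -> x \in rem y d.
Proof.
move=> xy; case yd : (y \in d); last by rewrite rem_id ?yd.
by rewrite (perm_mem (perm_to_rem yd)) inE (negbTE xy).
Qed.

Lemma mu1_cons x d : mu1 (x :: d) = (x == 1) + mu1 d.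
Proof. by []. Qed.

Lemma muodd_cons x d : muodd (x :: d) = (odd x && (1 < x)) + muodd d.
Proof. by []. Qed.

Section Build.
(** [P] stands for realizability. The hypotheses are all that the induction needs from graphs; [k]
    is odd in [P_ear] because the glued cycle has [k + 1] vertices. *)
Variable P : seq nat -> Prop.
Hypothesis P_perm : forall d d', perm_eq d d' -> P d -> P d'.
Hypothesis P_point : P [:: 0].
Hypothesis P_pendant : forall x d, P (x :: d) -> P (x.+1 :: 1 :: d).
Hypothesis P_ear : forall k x d, 3 <= k -> odd k ->
  P (x :: d) -> P (x.+2 :: nseq k 2 ++ d).

(* [c] is the number of cycles and [t] the slack in the degree inequality.
   The steps other than removing a [2] keep [t], so an odd slack must be spent
   on a [2] subdividing a bridge before the last bridge disappears. *)
Lemma cactus_sequence_ind (d : seq nat) (c t : nat) :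
  all (leq 1) d -> sumn d + 2 = 2 * size d + 2 * c ->
  size d = 3 * c + beta d + t + 1 -> 0 < c ->
  ~~ odd t \/ 2 <= mu1 d + muodd d -> P d.
Proof.
have [N] := ubnP (size d); elim: N d c t => // N IH d c t.
have step (d' : seq nat) : perm_eq d d' ->
    [/\ mu1 d = mu1 d', muodd d = muodd d', size d = size d', sumn d = sumn d'
      & all (leq 1) d = all (leq 1) d'] /\ (P d' -> P d).
  move=> pd; split; last by apply: P_perm; rewrite perm_sym.
  split; [exact: mu1_perm|exact: muodd_perm|exact: perm_size|exact: perm_sumn|exact: perm_all].
move=> ltN pos sumd szd c0 ht; rewrite /beta in szd.
have par : ~~ odd (mu1 d + muodd d).
  by rewrite -odd_sumn; move: sumd; lia.
have le3 := size3_le_sumn pos; have le2 := size2_le_sumn pos.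
have ex3 : 2 * size d < sumn d + mu1 d -> exists2 x, x \in d & 3 <= x.
  move=> lt; apply/hasP; apply/negPn; rewrite -all_predC; apply/negP => H.
  have := @sumn_le_size2 d _ pos.
  rewrite (@eq_all _ _ (predC (leq 3))) => [/(_ H)|z /=]; lia.
have [a0|a1] := posnP (mu1 d).
  (* No leaf is left. With several cycles, [le3] yields three entries 2 and the sum yields an entry
     at least 3, from which a 4-cycle is removed. *)
  have [c2|c1] := ltnP 1 c.
    have [d' Pd] : exists d', perm_eq d (nseq 3 2 ++ d').
      by apply: perm_nseq_count; lia.
    have [|[|[|[|x]]] xd x3 //] := ex3; first lia.
    have xd' : x.+3 \in d'.
      by move: xd; rewrite (perm_mem Pd) mem_cat mem_nseq.
    have Pd2 : perm_eq d (x.+3 :: nseq 3 2 ++ rem x.+3 d').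
      rewrite (perm_trans Pd) // -[_ :: _]/([:: x.+3] ++ _ ++ _) perm_sym perm_catCA.
      by rewrite perm_cat2l perm_sym perm_to_rem.
    have [[e1 e2 e3 e4 e5] wP] := step _ Pd2.
    apply: wP; apply: P_ear => //.
    move: e1 e2 e3 e4 e5; set r : seq nat := rem _ _.
    rewrite pos ?(mu1_cons, muodd_cons) /= => e1 e2 e3 e4 /esym pr.
    (* The case [x = 0] is apart: the entry 3 becomes a leaf. Then [beta] is kept, since the number
       of odd entries is even and positive. *)
    by case: x {Pd2 xd xd' x3} @r e1 e2 e3 e4 pr => [|x] r e1 e2 e3 e4 pr;
      apply: (IH _ c.-1 t); rewrite ?/beta ?(mu1_cons, muodd_cons) /= ?pr //; lia.
  have dE : d = nseq (size d) 2.
    apply/all_pred1P/allP => x xd.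
    have := allP pos x xd; have : x != 1.
      apply/eqP => x1; move: a0; rewrite /mu1 => /eqP; rewrite -leqn0 leqNgt -has_count.
      by move/hasP; apply; exists x => //; apply/eqP.
    have : ~~ (3 <= x).
      apply/negP => x3; have : has (leq 3) d by apply/hasP; exists x.
      by rewrite has_count; lia.
    by rewrite /=; lia.
  have o0 : muodd d = 0 by rewrite dE /muodd count_nseq.
  (* The cycle has [t + 4] vertices; [t] is even because [ht] cannot hold by its second alternative
     without odd entries. *)
  have := @P_ear (size d).-1 0 [::] _ _ P_point; rewrite cats0.
  have -> : 2 :: nseq (size d).-1 2 = d by rewrite [in RHS]dE; case: (size d) szd => //; lia.
  by apply; lia.
have in1 : 1 \in d by rewrite -has_pred1 has_count.
(* Removing a 2 next to a leaf leaves [c] and [beta] alone and lowers [t] by one, making it even. *)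
have [/andP[ot in2]|no2] := boolP (odd t && (2 \in d)).
  have Pd : perm_eq d (2 :: 1 :: rem 1 (rem 2 d)).
    rewrite (perm_trans (perm_to_rem in2)) // perm_cons perm_to_rem //.
    exact: mem_rem_neq.
  have [[e1 e2 e3 e4 e5] wP] := step _ Pd.
  apply: wP; apply: P_pendant; move: e1 e2 e3 e4 e5; set r : seq nat := rem _ _.
  rewrite pos ?(mu1_cons, muodd_cons) /= => e1 e2 e3 e4 /esym pr.
  by apply: (IH _ c t.-1); rewrite ?/beta ?(mu1_cons, muodd_cons) /= ?pr //; lia.
(* With an odd slack and no entry 2, [le3] forces more than two odd entries. So the next move, which
   loses two of them, keeps the condition [ht]. *)
have spare : odd t -> 2 < mu1 d + muodd d.
  move=> ot; move: no2; rewrite ot /= => no2.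
  have n2 : count_mem 2 d = 0 by apply/count_memPn.
  by lia.
(* If all odd entries are leaves, then [beta] is [mu1 d], and removing two leaves at an even entry
   lowers the size and [beta] by 2. *)
have [o0|o1] := posnP (muodd d).
  have [|x xd x3] := ex3; first lia.
  have xe : ~~ odd x.
    apply/negP => ox; have : has (fun x => odd x && (1 < x)) d.
      by apply/hasP; exists x => //; rewrite ox; lia.
    by rewrite has_count -/(muodd d) o0.
  case: x xd x3 xe => [|[|[|[|x]]]] // xd _ xe.
  have [d' Pd] : exists d', perm_eq d (nseq 2 1 ++ d').
    by apply: perm_nseq_count; rewrite -/(mu1 d); lia.
  have xd' : x.+4 \in d'.
    by move: xd; rewrite (perm_mem Pd) mem_cat mem_nseq.
  have Pd2 : perm_eq d (x.+4 :: nseq 2 1 ++ rem x.+4 d').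
    rewrite (perm_trans Pd) // -[_ :: _]/([:: x.+4] ++ _ ++ _) perm_sym perm_catCA.
    by rewrite perm_cat2l perm_sym perm_to_rem.
  have [[e1 e2 e3 e4 e5] wP] := step _ Pd2.
  apply: wP; apply: P_pendant.
  apply: (P_perm (d := x.+3 :: 1 :: rem x.+4 d')) => //.
  apply: P_pendant.
  move: e1 e2 e3 e4 e5; set r : seq nat := rem _ _.
  rewrite pos ?(mu1_cons, muodd_cons) /= => e1 e2 e3 e4 /esym pr.
  by apply: (IH _ c t); rewrite ?/beta ?(mu1_cons, muodd_cons) /= ?pr //; lia.
(* Removing a leaf at an odd entry makes that entry even, so both terms of the maximum in [beta]
   drop by 1, as does the size. *)
have /hasP[x xd /andP[ox x1]] : has (fun x => odd x && (1 < x)) d by rewrite has_count.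
case: x xd ox x1 => [|[|[|x]]] // xd ox _.
have Pd : perm_eq d (x.+3 :: 1 :: rem 1 (rem x.+3 d)).
  rewrite (perm_trans (perm_to_rem xd)) // perm_cons perm_to_rem //.
  exact: mem_rem_neq.
have [[e1 e2 e3 e4 e5] wP] := step _ Pd.
apply: wP; apply: P_pendant; move: e1 e2 e3 e4 e5; set r : seq nat := rem _ _.
rewrite pos ?(mu1_cons, muodd_cons) /= => e1 e2 e3 e4 /esym pr.
by apply: (IH _ c t); rewrite ?/beta ?(mu1_cons, muodd_cons) /= ?pr //; lia.
Qed.
End Build.

(** * Gluing a cycle at a vertex *)

Lemma connect_homo (T U : finType) (e : rel T) (e' : rel U) (f : T -> U) x y :
  (forall u v, e u v -> e' (f u) (f v)) -> connect e x y -> connect e' (f x) (f y).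
Proof.
move=> fe /connectP[p + ->]; elim: p x => //= z p IH x /andP[xz /IH].
by apply: connect_trans; apply/connect1/fe.
Qed.

Section Embedding.
Variables (T U : finType) (f : T -> U) (e : rel T) (e' : rel U).
Hypothesis f_inj : injective f.
Hypothesis e'f : forall x y, e' (f x) (f y) = e x y.

Lemma gcycle_map s : gcycle e' (map f s) <-> gcycle e s.
Proof.
have ce : cycle e' (map f s) = cycle e s.
  by rewrite cycle_map; apply: eq_cycle => x y /=.
by rewrite /gcycle size_map map_inj_uniq // ce.
Qed.

Lemma gcycle_edges_map s : uniq s ->
  gcycle_edges (map f s) = [set f @: (E : {set T}) | E in gcycle_edges s].
Proof.
move=> us; apply/setP => F; apply/imsetP/imsetP => [[_ /mapP[x xs ->] ->]|[_ /imsetP[x xs ->] ->]].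
  exists [set x; next s x]; last by rewrite next_map // imsetU1 imset_set1.
  by apply/imsetP; exists x.
exists (f x); first by rewrite map_f.
by rewrite next_map // imsetU1 imset_set1.
Qed.

End Embedding.

Lemma gcactus_map_inv (T U : finType) (f : T -> U) (e : rel T) (e' : rel U) :
  injective f -> (forall x y, e' (f x) (f y) = e x y) -> gcactus e' -> gcactus e.
Proof.
move=> fi fe ca s1 s2 c1 c2 E E1 E2.
have [_ u1 _] := c1; have [_ u2 _] := c2.
have := ca _ _ (proj2 (gcycle_map fi fe s1) c1) (proj2 (gcycle_map fi fe s2) c2) (f @: E).
rewrite !gcycle_edges_map // => /(_ (imset_f _ E1) (imset_f _ E2)).
by apply: imset_inj; apply: imset_inj.
Qed.

(* [ear e v k] glues to [v] a cycle with [k] new vertices; for [k = 1] the two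
   new edges coincide and it is a pendant vertex. *)
Section Ear.
Variables (T : finType) (e : rel T) (v : T) (k : nat).
Hypotheses (ie : irreflexive e) (se : symmetric e).

Definition ear : rel (T + 'I_k) := fun a b =>
  match a, b with
  | inl x, inl y => e x y
  | inl x, inr j => (x == v) && ((j == 0 :> nat) || (j.+1 == k))
  | inr i, inl y => (y == v) && ((i == 0 :> nat) || (i.+1 == k))
  | inr i, inr j => (i.+1 == j) || (j.+1 == i)
  end.

(** Position [i] on the closed walk along the ear: the new vertices are at 1 to [k], and [insub]
    fails beyond them, so that position [k + 1] is [v] again. *)
Definition ear_pt (i : nat) : T + 'I_k :=
  if i is j.+1 then oapp inr (inl v) (insub j) else inl v.

Lemma ear_ptS (i : 'I_k) : ear_pt i.+1 = inr i.
Proof. by rewrite /= insubT // => h; congr inr; apply: val_inj. Qed.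

Lemma ear_pt_Ordinal m (mk : m < k) : ear_pt m.+1 = inr (Ordinal mk).
Proof. exact: (ear_ptS (Ordinal mk)). Qed.

Lemma ear_irr : irreflexive ear.
Proof. by case=> [x|i] /=; [exact: ie|lia]. Qed.

Lemma ear_sym : symmetric ear.
Proof. by case=> [x|i] [y|j] //=; rewrite orbC. Qed.

Lemma eq_ear_pt b j : (b == ear_pt j) =
  match b with inl x => (x == v) && ((j == 0) || (k < j)) | inr i => i.+1 == j end.
Proof.
case: j b => [|j] [x|i] //=; first by rewrite andbT.
  by case: insubP => [u ju uj|kj] /=; rewrite ltnS leqNgt; [rewrite ju andbF|rewrite kj andbT].
case: insubP => [u ju uj|kj] /=; first by rewrite -uj eqSS.
by apply/esym/eqP => -[ij]; move: kj; rewrite -ij ltn_ord.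
Qed.

(** The new vertex [i] is at position [i + 1], whence the indices [i] and [i + 2]. *)
Lemma ear_nbrs (i : 'I_k) b : ear (inr i) b = (b \in [set ear_pt i; ear_pt i.+2]).
Proof.
have lt := ltn_ord i; rewrite !inE !eq_ear_pt; case: b => [x|j] /=; last lia.
by case: (x == v) => //=; lia.
Qed.

Lemma ear_nbrs_v (j : 'I_k) : ear (inl v) (inr j) = (inr j \in [set ear_pt 1; ear_pt k]).
Proof. by rewrite !inE !eq_ear_pt /= eqxx eqSS. Qed.

Lemma ear_pt_neq (i : 'I_k) : (ear_pt i != ear_pt i.+2) = (1 < k).
Proof.
have lt := ltn_ord i; rewrite eq_sym eq_ear_pt /=.
case: insubP => [u ju uj|kj] /=; first by rewrite uj; lia.
by rewrite eqxx /=; lia.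
Qed.

Definition ear_edges : {set {set T + 'I_k}} :=
  [set E | [exists i : 'I_k, exists b, ear (inr i) b && (E == [set inr i; b])]].

(** A new vertex has only two neighbours, so a cycle through it uses both. Going on in both
    directions, the cycle takes in the whole ear up to [v], where both its edges are already ear
    edges. *)
Lemma ear_cycle s (i : 'I_k) : gcycle ear s -> inr i \in s -> gcycle_edges s = ear_edges.
Proof.
move=> cs is_; have us : uniq s by case: cs.
have nb (j : 'I_k) : inr j \in s ->
    ear_pt j != ear_pt j.+2 /\ [set next s (inr j); prev s (inr j)] = [set ear_pt j; ear_pt j.+2].
  by move=> js; apply: gcycle_deg2 ear_sym cs js _ => b; rewrite ear_nbrs.
have k2 : 1 < k by have [+ _] := nb _ is_; rewrite ear_pt_neq.
have edge (j : 'I_k) b : inr j \in s -> ear (inr j) b -> [set inr j; b] \in gcycle_edges s.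
  move=> js; rewrite mem_gcycle_edges // js ear_nbrs; case: (nb j js) => _ <-.
  by rewrite !inE.
have mem_edge a b : [set a; b] \in gcycle_edges s -> b \in s.
  by rewrite set2C mem_gcycle_edges // => /andP[].
have step (j : 'I_k) : inr j \in s -> ear_pt j \in s /\ ear_pt j.+2 \in s.
  by move=> js; split; apply: (mem_edge (inr j)); apply: edge; rewrite // ear_nbrs !inE eqxx ?orbT.
have down m : m <= i.+1 -> ear_pt (i.+1 - m) \in s.
  elim: m => [|m IH] mi; first by rewrite subn0 ear_ptS.
  have lt : i - m < k by have := ltn_ord i; lia.
  have := IH (ltnW mi); rewrite (_ : i.+1 - m = (i - m).+1); last by lia.
  by rewrite (ear_pt_Ordinal lt) => /step[].
have up m : m <= k.+1 -> ear_pt m \in s.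
  elim: m => [|m IH] mk; first by have := down _ (leqnn _); rewrite subnn.
  case: m IH mk => [|m] IH mk.
    by have := down i (leqnSn _); rewrite subSnn.
  have lt : m < k by [].
  by have := IH (ltnW mk); rewrite (ear_pt_Ordinal lt) => /step[].
have all_s (j : 'I_k) : inr j \in s by rewrite -ear_ptS up // ltnS ltnW.
have vs : inl v \in s by apply: (up 0).
have vnb : [set next s (inl v); prev s (inl v)] = [set ear_pt 1; ear_pt k].
  have [lt0 ltk] : 0 < k /\ k.-1 < k by lia.
  have E1 : ear_pt 1 = inr (Ordinal lt0) by rewrite -ear_pt_Ordinal.
  have Ek : ear_pt k = inr (Ordinal ltk) by rewrite -ear_pt_Ordinal prednK.
  have : [set inl v; ear_pt 1] \in gcycle_edges s.
    by rewrite set2C E1; apply: edge; rewrite //= eqxx.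
  have : [set inl v; ear_pt k] \in gcycle_edges s.
    by rewrite set2C Ek; apply: edge; rewrite //= eqxx prednK // eqxx orbT.
  have : ear_pt 1 != ear_pt k by rewrite E1 eq_ear_pt /=; lia.
  rewrite !mem_gcycle_edges // vs /= => ne /orP[]/eqP Ak /orP[]/eqP A1; move: ne;
    rewrite Ak A1 ?eqxx // => _; by rewrite set2C.
(* The vertices of the ear, [v] included. They are closed under [next s], so the cycle never leaves
   them. *)
pose W : pred (T + 'I_k) := fun a => if a is inl x then x == v else true.
have nextW a : a \in s -> W a -> W (next s a).
  case: a => [x _ /eqP->|j js _].
    have : next s (inl v) \in [set ear_pt 1; ear_pt k] by rewrite -vnb !inE eqxx.
    by case: (next s _) => // y; rewrite !inE !eq_ear_pt /=; case: (y == v).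
  have : ear (inr j) (next s (inr j)) by apply: gcycle_next.
  by case: (next s _) => //= x /andP[].
have sW a : a \in s -> W a.
  move=> as_; have := fconnect_cycle (cycle_next us) vs a.
  rewrite as_ => /iter_findex <-; elim: (findex _ _ _) => [|m IH] /=; first by apply/eqP.
  apply: nextW => //; elim: m {IH} => //= m IH; by rewrite mem_next.
apply/setP => E; apply/imsetP/idP => [[a as_ ->]|].
  have en := gcycle_next cs as_; rewrite inE; case: a as_ en => [x|j] as_ en; last first.
    by apply/existsP; exists j; apply/existsP; exists (next s (inr j)); rewrite en eqxx.
  have xv : x = v by apply/eqP; apply: (sW _ as_).
  have : next s (inl x) \in [set ear_pt 1; ear_pt k] by rewrite xv -vnb !inE eqxx.
  case: (next s _) en => [y|j] en; first by rewrite !inE !eq_ear_pt; lia.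
  move=> _; apply/existsP; exists j; apply/existsP; exists (inl x).
  by rewrite ear_sym en set2C eqxx.
rewrite inE => /existsP[j /existsP[b /andP[ejb /eqP->]]].
by have /imsetP := edge j b (all_s j) ejb.
Qed.

(** A cycle that meets a new vertex has edge set [ear_edges]; any other one comes from a cycle of
    [e]. A common edge forces both cycles to be of the same kind. *)
Lemma ear_cactus : gcactus e -> gcactus ear.
Proof.
move=> ca.
have old s : (forall i, inr i \notin s) -> exists t, s = map inl t.
  elim: s => [|[x|i] s IH] H; first by exists [::].
    have [|t ->] := IH; last by exists (x :: t).
    by move=> j; have := H j; rewrite inE.
  by have := H i; rewrite mem_head.
have new s E (j : 'I_k) : E \in ear_edges -> E \in gcycle_edges s -> exists i : 'I_k, inr i \in s.
  rewrite inE => /existsP[i /existsP[b /andP[_ /eqP->]]] /imsetP[a as_ Ea]; exists i.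
  have : inr i \in [set a; next s a] by rewrite -Ea !inE eqxx.
  by rewrite !inE => /orP[]/eqP->; rewrite ?mem_next.
move=> s1 s2 c1 c2 E E1 E2.
have [/existsP[i1 i1s]|n1] := boolP [exists i : 'I_k, inr i \in s1].
  have eq1 := ear_cycle c1 i1s; rewrite eq1 in E1.
  by have [i2 i2s] := new _ _ i1 E1 E2; rewrite eq1 (ear_cycle c2 i2s).
have [/existsP[i2 i2s]|n2] := boolP [exists i : 'I_k, inr i \in s2].
  have eq2 := ear_cycle c2 i2s; rewrite eq2 in E2.
  by have [i1 i1s] := new _ _ i2 E2 E1; case/existsP: n1; exists i1.
have [t1 t1E] : exists t, s1 = map inl t.
  by apply: old => i; apply: contraNN n1 => ?; apply/existsP; exists i.
have [t2 t2E] : exists t, s2 = map inl t.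
  by apply: old => i; apply: contraNN n2 => ?; apply/existsP; exists i.
have inl_inj : injective (@inl T 'I_k) by move=> x y [].
move: c1 c2 E1 E2; rewrite {}t1E {}t2E.
move=> /(gcycle_map inl_inj (e := e)) c1 /(gcycle_map inl_inj (e := e)) c2.
have {}c1 := c1 (fun _ _ => erefl); have {}c2 := c2 (fun _ _ => erefl).
have [_ u1 _] := c1; have [_ u2 _] := c2.
rewrite !gcycle_edges_map // => /imsetP[F1 F1s ->] /imsetP[F2 F2s] /(imset_inj inl_inj) F12.
by rewrite (ca _ _ c1 c2 F1) // F12.
Qed.

Lemma ear_connected : (forall x y, connect e x y) -> forall a b, connect ear a b.
Proof.
move=> con.
have vi m (mk : m < k) : connect ear (inl v) (inr (Ordinal mk)).
  elim: m mk => [|m IH] mk; first by apply: connect1; rewrite /= eqxx.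
  apply: connect_trans (IH (ltnW mk)) _; apply: connect1; by rewrite /= eqxx.
have va a : connect ear (inl v) a.
  case: a => [x|[m mk]]; last exact: vi.
  exact: (connect_homo (f := inl)) (con v x).
move=> a b; apply: connect_trans (va b).
by rewrite (sym_connect_sym ear_sym).
Qed.

(** Colours alternate along the ear. As [k] is odd, its first and last new vertices both have an
    even index and get the colour opposite to [v]. *)
Lemma ear_bipartite (c : T -> bool) : odd k -> (forall x y, e x y -> c x != c y) ->
  exists c' : T + 'I_k -> bool, forall a b, ear a b -> c' a != c' b.
Proof.
move=> ok bc; exists (fun a : T + 'I_k =>
  match a with inl x => c x | inr i => c v (+) ~~ odd i end).
have parity (i : 'I_k) : (i == 0 :> nat) || (i.+1 == k) -> ~~ odd i.
  by move: (nat_of_ord i) ok => m ok /orP[]/eqP E; [rewrite E|move: ok; rewrite -E].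
move=> [x|i] [y|j] /=; first exact: bc.
- by case/andP => /eqP-> /parity ->; case: (c v).
- by case/andP => /eqP-> /parity ->; case: (c v).
- by case/orP => /eqP <- /=; case: (c v); case: (odd _).
Qed.

Lemma ear_deg_old x : x != v -> gdeg ear (inl x) = gdeg e x.
Proof.
move=> xv; rewrite /gdeg -(card_imset _ (@inl_inj T 'I_k)).
congr #|pred_of_set _|; apply/setP => -[y|j]; rewrite !inE /=.
  by rewrite mem_imset ?inE // => ? ? [].
by rewrite (negbTE xv); apply/esym/negbTE/imsetP => -[].
Qed.

(** [v] gains the two ends of the ear, which coincide when [k = 1]. *)
Lemma ear_deg_base : 0 < k -> gdeg ear (inl v) = gdeg e v + (1 < k).+1.
Proof.
move=> k0; have [lt0 ltk] : 0 < k /\ k.-1 < k by lia.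
rewrite /gdeg -(card_imset [set y | e v y] (@inl_inj T 'I_k)).
have -> : (1 < k).+1 = #|[set ear_pt 1; ear_pt k]|.
  rewrite cards2 (ear_pt_Ordinal lt0) eq_ear_pt /=; lia.
rewrite -cardsUI (_ : _ :&: _ = set0) ?cards0 ?addn0.
  congr #|pred_of_set _|; apply/setP => -[y|j]; rewrite in_set in_setU.
    rewrite mem_imset => [|? ? [] //].
    by rewrite !inE !eq_ear_pt /=; case: (e v y) => //=; case: (y == v) => //=; lia.
  rewrite ear_nbrs_v [X in X || _](_ : _ = false) //.
  by apply/negbTE/imsetP => -[].
apply/setP => -[y|j]; rewrite in_setI in_set0.
  by rewrite !inE !eq_ear_pt; case: (_ \in _) => //=; case: (y == v) => //=; lia.
by rewrite [X in X && _](_ : _ = false) //; apply/negbTE/imsetP => -[].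
Qed.

Lemma ear_deg_new (i : 'I_k) : gdeg ear (inr i) = (1 < k).+1.
Proof.
rewrite -(ear_pt_neq i) -cards2; congr #|pred_of_set _|.
by apply/setP => b; rewrite inE ear_nbrs.
Qed.

End Ear.

(** * Realizations *)

(** An arbitrary finite vertex type and degrees up to permutation allow gluing by sum types, without
    renumbering vertices. *)
Definition realizable (d : seq nat) : Prop :=
  exists (T : finType) (e : rel T),
    [/\ perm_eq [seq gdeg e x | x <- enum T] d,
        irreflexive e /\ symmetric e, forall x y, connect e x y, gcactus e
      & exists c : T -> bool, forall x y, e x y -> c x != c y].

Lemma realizable_perm d d' : perm_eq d d' -> realizable d -> realizable d'.
Proof.
move=> dd' [T [e [pd se con ca bip]]]; exists T, e; split=> //.
exact: perm_trans pd dd'.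
Qed.

Lemma realizable_point : realizable [:: 0].
Proof.
exists unit, (fun _ _ => false); split => //.
- by rewrite enumT unlock /= /gdeg (_ : [set _ | _] = set0) ?cards0.
- by case; case.
- by move=> [|x [|y s]] s2 [].
- by exists xpredT.
Qed.

Lemma realizable_glue k x d : odd k -> realizable (x :: d) ->
  realizable (x + (1 < k).+1 :: nseq k (1 < k).+1 ++ d).
Proof.
move=> ok [T [e [pd [ie se] con ca [c bc]]]].
have /mapP[v _ xv] : x \in [seq gdeg e x | x <- enum T] by rewrite (perm_mem pd) mem_head.
exists (T + 'I_k)%type, (ear e v (k := k)); split; last 4 first.
- by split; [exact: ear_irr|exact: ear_sym].
- exact: ear_connected.
- exact: ear_cactus.
- exact: ear_bipartite bc.
have pT : perm_eq (enum T) (v :: rem v (enum T)) by rewrite perm_to_rem ?mem_enum.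
have pd' : perm_eq [seq gdeg e x | x <- rem v (enum T)] d.
  by rewrite -(perm_cons x) {1}xv -map_cons -(permPl (perm_map _ pT)).
have pU : perm_eq (enum {: T + 'I_k}) (map inl (enum T) ++ map inr (enum 'I_k)).
  apply: uniq_perm; first exact: enum_uniq.
    rewrite cat_uniq (map_inj_uniq inl_inj) (map_inj_uniq inr_inj) !enum_uniq andbT /=.
    by apply/hasPn => _ /mapP[i _ ->]; apply/mapP => -[].
  move=> [y|i]; rewrite mem_enum mem_cat ?inE; apply/esym/orP.
    by left; rewrite map_f ?mem_enum.
  by right; rewrite map_f ?mem_enum.
set g := gdeg _.
have newE : map g (map inr (enum 'I_k)) = nseq k (1 < k).+1.
  have /all_pred1P -> : all (pred1 (1 < k).+1) (map g (map inr (enum 'I_k))).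
    by rewrite -map_comp; apply/allP => _ /mapP[i _ ->]; apply/eqP/ear_deg_new.
  by rewrite 2!size_map size_enum_ord.
have oldE : perm_eq (map g (map inl (enum T))) (x + (1 < k).+1 :: d).
  rewrite -map_comp (permPl (perm_map _ pT)) /= /g ear_deg_base ?odd_gt0 // -xv perm_cons.
  rewrite -(permPr pd') (_ : map _ _ = [seq gdeg e x | x <- rem v (enum T)]) //.
  apply/eq_in_map => y; rewrite mem_rem_uniq ?enum_uniq // inE.
  by case/andP => yv _ /=; rewrite ear_deg_old.
apply: (perm_trans (perm_map g pU)); rewrite map_cat newE -cat1s.
by rewrite perm_sym perm_catCA perm_sym perm_catC perm_cat2l.
Qed.

Lemma realizable_pendant x d : realizable (x :: d) -> realizable (x.+1 :: 1 :: d).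
Proof. by move/(@realizable_glue 1 x d isT); rewrite addn1. Qed.

Lemma realizable_ear k x d : 3 <= k -> odd k -> realizable (x :: d) ->
  realizable (x.+2 :: nseq k 2 ++ d).
Proof. by move=> k3 ok /(realizable_glue ok); rewrite (ltnW k3) addn2. Qed.

(** Used to list the vertices in the order in which [d] lists their degrees, which gives the
    numbering by ordinals. *)
Lemma perm_map_lift (T : eqType) (g : T -> nat) (t : seq T) (d : seq nat) :
  perm_eq (map g t) d -> exists2 t', perm_eq t t' & map g t' = d.
Proof.
elim: d t => [|x d IH] t pt.
  by exists [::]; move/perm_size: pt; case: t.
have /mapP[y yt xE] : x \in map g t by rewrite (perm_mem pt) mem_head.
have py := perm_to_rem yt.
have [|t' pt' gt'] := IH (rem y t).
  by rewrite -(perm_cons x) {1}xE -map_cons -(permPl (perm_map _ py)).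
by exists (y :: t'); rewrite /= ?gt' ?xE // (permPl py) perm_cons.
Qed.

Lemma realizable_bi_cactus n d : size d = n -> realizable d ->
  exists e : rel 'I_n, realizes e d /\ bi_cactus e.
Proof.
move=> sd [T [e [pd [ie se] con ca [c bc]]]].
have [t pt dt] := perm_map_lift pd.
have st : size t == n by rewrite -sd -dt size_map.
pose f := tnth (Tuple st).
have fi : injective f.
  by apply/tuple_uniqP; rewrite /= -(perm_uniq pt) enum_uniq.
have fs x : exists i, x = f i.
  by apply/tnthP; rewrite memtE /= -(perm_mem pt) mem_enum.
have ft (i : 'I_n) : nth 0 d i = gdeg e (f i).
  have it : i < size t by rewrite (eqP st).
  by rewrite -dt (nth_map (f i)) // [in RHS]/f (tnth_nth (f i)).
exists (fun i j => e (f i) (f j)); split; [split; [split|]|split; [split|]].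
- by move=> i; rewrite ie.
- by move=> i j; rewrite se.
- move=> i; rewrite ft /deg /gdeg -(card_imset _ fi); congr #|pred_of_set _|.
  apply/setP => y; rewrite inE; apply/imsetP/idP => [[j]|ey].
    by rewrite inE => ej ->.
  by have [j yj] := fs y; exists j; rewrite // inE -yj.
- move=> i j.
  (* The inverse of [f]; the default [i] is never returned, as [f] is onto. *)
  pose g x : 'I_n := odflt i [pick i | f i == x].
  have gK x : f (g x) = x.
    rewrite /g; case: pickP => [l /eqP//|no].
    by have [l xl] := fs x; have := no l; rewrite -xl eqxx.
  have gf l : g (f l) = l by apply: fi.
  rewrite -(gf i) -(gf j); apply: connect_homo (con (f i) (f j)) => u w.
  by rewrite !gK.
- exact: gcactus_map_inv fi (fun _ _ => erefl) ca.
- by exists (c \o f) => i j; apply: bc.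
Qed.

(** * The degree bound and the equivalence *)

(** The arc count of [cactus_arcs] with the bridges bounded below by [beta]. The condition [3 <= n]
    excludes the single edge, whose two leaves share a bridge. *)
Lemma bi_cactus_bound n d (e : rel 'I_n) : 3 <= n -> size d = n ->
  realizes e d -> bi_cactus e -> 3 * sumn d + 2 * beta d + 8 <= 8 * n.
Proof.
move=> n3 sd [[ie0 se] dege] [[con ca] [c bc]].
have ie : irreflexive e by move=> x; apply/negbTE.
have dE : d = [seq gdeg e x | x <- enum 'I_n].
  apply: (@eq_from_nth _ 0) => [|i]; first by rewrite size_map size_enum_ord.
  rewrite sd => li.
  rewrite (nth_map (Ordinal li)) ?size_enum_ord // -[RHS]/(deg e _) dege.
  by rewrite nth_enum_ord.
have countE (p : pred nat) : count p d = #|[set x | p (gdeg e x)]|.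
  by rewrite dE count_map cardsE cardE enumT size_filter.
have sumE : sumn d = num_arcs e.
  by rewrite num_arcsE dE sumnE big_map big_enum.
have := cactus_arcs ie se ca bc; rewrite card_ord => /(_ (ltnW (ltnW n3))).
have B1 := odd_deg_bridges se ca.
have B2 : 2 * mu1 d <= num_arcs (bridge e).
  rewrite /mu1 countE; apply: leaf_bridges => // x y exy dx; apply/eqP => dy.
  by have := adjacent_leaves se con exy dx dy; rewrite card_ord leqNgt n3.
have E : mu1 d + muodd d = #|[set x | odd (gdeg e x)]|.
  rewrite -countE /mu1 /muodd; elim: (d) => //= x d' <-; case: x => [|[|x]] //=; lia.
rewrite -E in B1; rewrite -sumE /beta; lia.
Qed.

Theorem theorem7p3 (n : nat) (d : seq nat) :
  degree_sequence n d ->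
  2 <= nth 0 d 3 ->
  2 * n < sumn d ->
  2 <= muodd d + mu1 d ->
  (exists e : rel 'I_n, realizes e d /\ bi_cactus e) <->
  (sumn d)./2 <= (4 * (n - 1) - beta d) %/ 3.
Proof.
case=> sd pos ev _ d4 lt2 odd2.
(* [nth] returns 0 past the end, so a fourth entry of at least 2 must really exist. *)
have n4 : 3 < n by rewrite -sd ltnNge; apply/negP => le; rewrite nth_default in d4.
rewrite leq_divRL //; split=> [[e [re bi]]|le].
  by have := bi_cactus_bound (ltnW n4) sd re bi; lia.
apply: realizable_bi_cactus => //.
(* [c] is the cyclomatic number [m - n + 1] and [t] the gap in the bound; by [lt2] and [le] the
   truncated subtractions are exact. *)
apply: (cactus_sequence_ind realizable_perm realizable_point realizable_pendant realizable_ear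
  (c := (sumn d)./2 - n + 1) (t := 4 * (n - 1) - beta d - (sumn d)./2 * 3)).
- by apply: sub_all pos => x /andP[].
- lia.
- lia.
- lia.
- by right; rewrite addnC.
Qed.
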